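(* Let $A\subseteq\Gamma$ be a finite set and $M\ge1$ a real number. (i) Suppose $\mathsf{T}_4(A)\ge|A|^4\mathsf{E}(A)/M$. Then there is $A'\subseteq A$ with $$|A'|\gg\frac{|A|}{M^3\log^{16/3}|A|}\quad\text{and}\quad |nA'-mA'|\ll(M^3\log^4|A|)^{4(n+m)}M|A'|\cdot\frac{|A|^3}{\mathsf{E}(A)}$$ for all positive integers $n,m$. (ii) More generally, if $s\ge2$ is an integer and $\mathsf{T}_{2s}(A)\ge|A|^{2s}\mathsf{T}_s(A)/M$, then there is $A'\subseteq A$ with $|A'|\gg_s|A|/(M^3\log^{16/3}|A|)$ and $|nA'-mA'|\ll_s(M^3\log^4|A|)^{4(n+m)}M|A'|\cdot|A|^{2s-1}/\mathsf{T}_s(A)$ for all positive integers $n,m$. (iii) Conversely, if $s\ge2$ and some $A'\subseteq A$ satisfies the two bounds of (ii), then $\mathsf{T}_{2s}(A)\gg_{M,\log|A|,s}|A|^{2s}\mathsf{T}_s(A)$.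
   Context: $\Gamma$ is an abelian group. $\mathsf{E}(A)=|\{a_1-a_2=a_3-a_4: a_i\in A\}|$ and $\mathsf{T}_k(A)=|\{(a_1,\dots,a_k,a_1',\dots,a_k')\in A^{2k}: a_1+\dots+a_k=a_1'+\dots+a_k'\}|$ (so $\mathsf{T}_2(A)=\mathsf{E}(A)$). $nA-mA$ denotes the set of sums of $n$ elements of $A$ minus sums of $m$ elements of $A$. $\ll_s$ hides a constant depending on $s$ only; $X\gg_{M,\log|A|,s}Y$ means $X\ge c_s(M\log|A|)^{-C_s}Y$ with $c_s,C_s>0$ depending only on $s$. Logarithms base 2. *)

(* Defs.v *)
From HB Require Import structures.
From mathcomp Require Import all_boot all_order all_algebra finmap.
From mathcomp Require Import reals exp.
From mathcomp Require Import Rstruct.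

Set Implicit Arguments.
Unset Strict Implicit.
Unset Printing Implicit Defensive.

Import Order.TTheory GRing.Theory Num.Theory.
Local Open Scope ring_scope.
Local Open Scope fset_scope.

(* The ambient abelian group Gamma is a zmodType G; finite subsets are {fset G}.
   The elements of A : {fset G} form a finType, so k.-tuple A is a finType. *)

Definition tsum (G : zmodType) (A : {fset G}) (k : nat) (t : k.-tuple A) : G :=
  \sum_(i < k) val (tnth t i).

Definition Tk (G : zmodType) (k : nat) (A : {fset G}) : nat :=
  #|[set p : k.-tuple A * k.-tuple A | tsum p.1 == tsum p.2]|.

Definition energy (G : zmodType) (A : {fset G}) : nat :=
  #|[set p : (A * A) * (A * A) |
       val p.1.1 - val p.1.2 == val p.2.1 - val p.2.2]|.

Definition sumdiff (G : zmodType) (n m : nat) (A : {fset G}) : {fset G} :=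
  [fset tsum p.1 - tsum p.2 | p in [set: n.-tuple A * m.-tuple A]].

Notation RR := Rdefinitions.R.
Definition log2 (x : RR) : RR := ln x / ln 2.

(* Main.v *)
Require Import Defs.
From HB Require Import structures.
From mathcomp Require Import all_boot all_order all_algebra finmap.
From mathcomp Require Import reals exp Rstruct.
From mathcomp Require Import zify ring lra.

(** Let [f(x)] be the number of representations of [x] as a sum of [s] elements
    of [A], so that [T_s] and [T_2s] are the squared L2 norm and the additive
    energy of [f], and the hypothesis of (ii) reads
    [E(f) >= |f|_1^2 |f|_2^2 / M].  Values of [f] above [8 M |f|_2^2 / |f|_1]
    carry at most half of this energy and are discarded.  For a suitable [d],
    most pairs of the set [{x : f(x) f(x - d) > 0}], weighted by
    [f(x) f(x - d)], have a popular difference; this yields a set [S] with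
    small [S - S] that has a large share of the mass of [f].  As [f] is the
    convolution of the indicator of [A] with another function, some translate
    of [S] has a large intersection [A'] with [A], and Petridis' form of the
    Plünnecke inequality with the Ruzsa triangle inequality bounds [nA' - mA'].
    No dyadic decomposition is involved, hence there is no logarithmic loss;
    the logarithms only serve to absorb constants of the form [K^(n + m)].
    The converse (iii) is Cauchy-Schwarz applied to [2s]-fold sums of [A']. *)

Set Implicit Arguments.
Unset Strict Implicit.
Unset Printing Implicit Defensive.

Import Order.TTheory GRing.Theory Num.Theory.
Local Open Scope fset_scope.
Local Open Scope ring_scope.

(** * The Plünnecke–Ruzsa inequality *)

Section Sumsets.
Variable G : zmodType.
Implicit Types A B C X Y Z : {fset G}.

Definition addfs A B : {fset G} := [fset a + b | a in A, b in B].
Definition subfs A B : {fset G} := [fset a - b | a in A, b in B].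
Definition shift c A : {fset G} := [fset a + c | a in A].
Definition nfold n A : {fset G} := iter n (addfs A) [fset 0].

Lemma addfsP A B x :
  reflect (exists a b, [/\ a \in A, b \in B & x = a + b]) (x \in addfs A B).
Proof.
apply: (iffP idP) => [/imfset2P[a aA [b bB ->]]|[a [b [aA bB ->]]]].
  by exists a, b.
by apply/imfset2P; exists a => //; exists b.
Qed.

Lemma subfsP A B x :
  reflect (exists a b, [/\ a \in A, b \in B & x = a - b]) (x \in subfs A B).
Proof.
apply: (iffP idP) => [/imfset2P[a aA [b bB ->]]|[a [b [aA bB ->]]]].
  by exists a, b.
by apply/imfset2P; exists a => //; exists b.
Qed.

Lemma mem_addfs A B a b : a \in A -> b \in B -> a + b \in addfs A B.
Proof. by move=> aA bB; apply/addfsP; exists a, b. Qed.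

Lemma mem_shift c A x : (x \in shift c A) = (x - c \in A).
Proof.
apply/imfsetP/idP => [[a /= aA ->]|xA]; first by rewrite addrK.
by exists (x - c) => //; rewrite subrK.
Qed.

Lemma card_shift c A : #|` shift c A| = #|` A|.
Proof. by rewrite card_imfset //=; apply: addIr. Qed.

Lemma addfsA A B C : addfs A (addfs B C) = addfs (addfs A B) C.
Proof.
apply/fsetP => x; apply/addfsP/addfsP => [[a [_ [aA /addfsP[b [c [bB cC ->]]] ->]]]|].
  by exists (a + b), c; split; rewrite ?addrA // mem_addfs.
case=> _ [c [/addfsP[a [b [aA bB ->]]] cC ->]].
by exists a, (b + c); split; rewrite ?addrA // mem_addfs.
Qed.

Lemma addfs0 A : addfs A fset0 = fset0.
Proof.
apply/fsetP => x; rewrite in_fset0; apply/addfsP => -[a [b []]].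
by rewrite in_fset0.
Qed.

Lemma addfs_singleton0 A : addfs A [fset 0] = A.
Proof.
apply/fsetP => x; apply/addfsP/idP => [[a [b [aA]]]|xA].
  by rewrite in_fset1 => /eqP-> ->; rewrite addr0.
by exists x, 0; rewrite in_fset1 addr0.
Qed.

Lemma addfsU1 A B c : addfs A (c |` B) = shift c A `|` addfs A B.
Proof.
apply/fsetP => x; rewrite in_fsetU mem_shift; apply/addfsP/orP.
  case=> a [b [aA]]; rewrite in_fset1U => /orP[/eqP->|bB] ->.
    by left; rewrite addrK.
  by right; rewrite mem_addfs.
case=> [xA|/addfsP[a [b [aA bB ->]]]].
  by exists (x - c), c; rewrite fset1U1 subrK.
by exists a, b; rewrite in_fset1U bB orbT.
Qed.

(* Petridis: in the inductive step, [Z] collects the points of [X] whose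
   translate by [c] contributes nothing new to [X + B + C]. *)
Lemma petridis B X : (forall Z, Z `<=` X ->
    (#|` addfs X B| * #|` Z| <= #|` addfs Z B| * #|` X|)%N) ->
  forall C, (#|` addfs (addfs X B) C| * #|` X| <=
             #|` addfs X B| * #|` addfs X C|)%N.
Proof.
move=> minX; elim/finSet_rect => C IH.
case: (fset_0Vmem C) => [->|[c cC]]; first by rewrite !addfs0 cardfs0.
have := IH _ (fproperD1 cC); set C' := C `\ c => {}IH.
rewrite -(fsetD1K cC) -/C' !addfsU1.
pose Z := [fset x in X | shift (x + c) B `<=` addfs (addfs X B) C'].
have ZX : Z `<=` X by apply/fsubsetP => x; rewrite !inE => /andP[].
(* By the choice of [Z], the translate of Z + B by [c] lies in both sets of the union, so
   inclusion-exclusion saves |Z + B|. *)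
have ubXBC : (#|` shift c (addfs X B) `|` addfs (addfs X B) C'| +
              #|` addfs Z B| <= #|` addfs (addfs X B) C'| + #|` addfs X B|)%N.
  rewrite -(card_shift c (addfs X B)) -(card_shift c (addfs Z B)).
  rewrite [leqRHS]addnC -[leqRHS]cardfsUI leq_add2l fsubset_leq_card //.
  apply/fsubsetP => y; rewrite in_fsetI !mem_shift => /addfsP[z [b [zZ bB e]]].
  move: (zZ); rewrite !inE => /andP[zX /fsubsetP sub].
  rewrite e mem_addfs //=; apply: sub; rewrite mem_shift.
  by rewrite opprD addrA addrAC e addrC addKr.
(* A point y = x + c' common to both sets satisfies y + B ⊆ X + B + C', so that y - c lies in [Z]:
   the overlap is at most |Z|. *)
have lbXC : (#|` addfs X C'| + #|` X| <=
             #|` shift c X `|` addfs X C'| + #|` Z|)%N.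
  rewrite -(card_shift c X) addnC -[leqLHS]cardfsUI leq_add2l -(card_shift c Z).
  rewrite fsubset_leq_card //.
  apply/fsubsetP => y; rewrite in_fsetI !mem_shift => /andP[yX].
  case/addfsP => x [c' [xX c'C e]]; rewrite !inE yX subrK /=.
  apply/fsubsetP => t; rewrite mem_shift => tB; apply/addfsP.
  exists (x + (t - y)), c'; rewrite mem_addfs //; split=> //.
  by rewrite addrAC -e addrC subrK.
have := minX Z ZX; nia.
Qed.

Lemma exists_min_ratio A B : A != fset0 -> exists X, [/\ X `<=` A, X != fset0 &
  forall Z, Z `<=` A -> (#|` addfs X B| * #|` Z| <= #|` addfs Z B| * #|` X|)%N].
Proof.
move=> A0; have AA : A \in fpowerset A by rewrite fpowersetE.
pose F (X : fpowerset A) := (#|` addfs (val X) B|%:R / #|` val X|%:R : rat).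
case: (@arg_minP _ _ _ [` AA] (fun Y : fpowerset A => val Y != fset0) F) => //= X X0 minX.
exists (val X); split=> //; first by rewrite -fpowersetE (valP X).
move=> Z; rewrite -fpowersetE => ZA.
case: (eqVneq Z fset0) => [->|Z0]; first by rewrite cardfs0 muln0.
have := minX [` ZA] Z0; rewrite /F /=.
rewrite ler_pdivrMr ?ltr0n ?cardfs_gt0 // mulrAC.
by rewrite ler_pdivlMr ?ltr0n ?cardfs_gt0 // -!natrM ler_nat.
Qed.

(* Each [d] in [B - C] comes with a fixed representation [d = b - c], from
   which [(x + b, x + c)] determines first [d], then [b] and [x]. *)
Lemma ruzsa_triangle X B C :
  (#|` subfs B C| * #|` X| <= #|` addfs X B| * #|` addfs X C|)%N.
Proof.
have rep (d : subfs B C) : exists p : G * G,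
    [&& p.1 \in B, p.2 \in C & val d == p.1 - p.2].
  case/subfsP: (valP d) => b [c [bB cC e]]; exists (b, c) => /=.
  by rewrite bB cC; apply/eqP.
pose g d := xchoose (rep d).
pose f (p : subfs B C * X) : G * G :=
  (val p.2 + (g p.1).1, val p.2 + (g p.1).2).
have gP d : [/\ (g d).1 \in B, (g d).2 \in C & val d = (g d).1 - (g d).2].
  by have /and3P[? ? /eqP] := xchooseP (rep d).
have finj : injective f.
  move=> [d x] [d' x'] [/= e1 e2].
  have ed : d = d'.
    apply: val_inj; have [_ _ ->] := gP d; have [_ _ ->] := gP d'.
    have e a b c : a + b - (a + c) = b - c :> G by rewrite opprD addrACA subrr add0r.
    by rewrite -(e (val x)) -[RHS](e (val x')) e1 e2.
  by move: e1; rewrite ed => /addIr/val_inj->.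
have inB p : (f p).1 \in addfs X B by rewrite mem_addfs ?(valP p.2) //; case: (gP p.1).
have inC p : (f p).2 \in addfs X C by rewrite mem_addfs ?(valP p.2) //; case: (gP p.1).
rewrite !cardfE -!card_prod.
apply: (@leq_card _ _ (fun p => ([` inB p], [` inC p]))) => p q [e1 e2].
by apply: finj; apply/eqP; rewrite xpair_eqE e1 e2 !eqxx.
Qed.

Lemma nfoldS n A : nfold n.+1 A = addfs A (nfold n A).
Proof. by []. Qed.

Lemma tsum_in_nfold n A (t : n.-tuple A) : tsum t \in nfold n A.
Proof.
elim: n t => [|n IH] t; first by rewrite /tsum big_ord0 in_fset1.
case/tupleP: t => a t; rewrite /tsum big_ord_recl tnth0 nfoldS.
under eq_bigr do rewrite tnthS.
by apply: mem_addfs; [apply: valP | apply: IH].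
Qed.

(** A minimiser [X] inside [Q] inherits the ratio [k], Petridis gives |X + jA| <= k^j |X| by
    induction on j, and the triangle inequality with pivot [X] finishes. [Q] and [A] are separate
    sets because [Q] will be the negative of the structured set. *)
Lemma plunnecke_ruzsa (R : realFieldType) (k : R) Q A n m :
    Q != fset0 -> #|` addfs Q A|%:R <= k * #|` Q|%:R ->
  #|` sumdiff n m A|%:R <= k ^+ (n + m) * #|` Q|%:R.
Proof.
move=> Q0 leK; have [X [XQ X0 minX]] := exists_min_ratio A Q0.
have Xgt0 : 0 < #|` X|%:R :> R by rewrite ltr0n cardfs_gt0.
have Qgt0 : 0 < #|` Q|%:R :> R by rewrite ltr0n cardfs_gt0.
have k0 : 0 <= k by rewrite -(pmulr_lge0 _ Qgt0) (le_trans _ leK).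
have leX : #|` addfs X A|%:R <= k * #|` X|%:R.
  have := minX Q (fsubset_refl _); rewrite -(ler_nat R) !natrM => h.
  rewrite -(ler_pM2r Qgt0) (le_trans h) // mulrAC.
  by rewrite ler_pM2r.
have growth j : #|` addfs X (nfold j A)|%:R <= k ^+ j * #|` X|%:R.
  elim: j => [|j IH]; first by rewrite addfs_singleton0 mul1r.
  rewrite nfoldS addfsA -(ler_pM2r Xgt0).
  have := petridis (fun Z ZX => minX Z (fsubset_trans ZX XQ)) (nfold j A).
  rewrite -(ler_nat R) !natrM => /le_trans; apply.
  rewrite (le_trans (ler_pM _ _ leX IH)) // exprS.
  by rewrite le_eqVlt; apply/orP; left; apply/eqP; ring.
have sub : sumdiff n m A `<=` subfs (nfold n A) (nfold m A).
  apply/fsubsetP => x /imfsetP[[t u] /= _ ->]; apply/subfsP.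
  by exists (tsum t), (tsum u); split=> //; apply: tsum_in_nfold.
apply: (@le_trans _ _ (k ^+ (n + m) * #|` X|%:R)); last first.
  by rewrite ler_wpM2l ?exprn_ge0 // ler_nat fsubset_leq_card.
rewrite -(ler_pM2r Xgt0).
have := ruzsa_triangle X (nfold n A) (nfold m A).
rewrite -(ler_nat R) !natrM => tri.
have : #|` sumdiff n m A|%:R * #|` X|%:R <=
       #|` subfs (nfold n A) (nfold m A)|%:R * #|` X|%:R :> R.
  by rewrite ler_pM2r // ler_nat fsubset_leq_card.
move=> /le_trans; apply; apply: (le_trans tri).
rewrite (le_trans (ler_pM _ _ (growth n) (growth m))) // exprD.
by rewrite le_eqVlt; apply/orP; left; apply/eqP; ring.
Qed.

End Sumsets.

(** * The Balog–Szemerédi–Gowers theorem for multisets *)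

Lemma card_sumr (R : nzSemiRingType) (X : finType) (P : pred X) :
  #|[set x | P x]|%:R = \sum_(x | P x) 1 :> R.
Proof. by rewrite sumr_const cardsE. Qed.

Lemma sumr_const_seq (R : nzSemiRingType) (I : Type) (S : seq I) (c : R) :
  \sum_(i <- S) c = (size S)%:R * c.
Proof. by rewrite big_const_seq iter_addr_0 count_predT mulr_natl. Qed.

(** * Counting along the fibres of a map *)

Section Fibers.
Variables (R : realFieldType) (X : finType) (T : eqType) (phi : X -> T).

Lemma sum_fibers (S : seq T) (P : pred X) (F : X -> R) :
    uniq S -> (forall x, P x -> phi x \in S) ->
  \sum_(x | P x) F x = \sum_(d <- S) \sum_(x | P x && (phi x == d)) F x.
Proof.
move=> uS phiS; rewrite (exchange_big_dep P) /=; last by move=> d x _ /andP[].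
apply: eq_bigr => x Px; rewrite (eq_bigl (pred1 (phi x))); last first.
  by move=> d; rewrite Px /= eq_sym.
by rewrite big_const_seq iter_addr_0 count_uniq_mem // phiS // mulr1n.
Qed.

Lemma card_fibers_le (S : seq T) (P : pred X) (h : R) :
    uniq S -> (forall x, P x -> phi x \in S) ->
    (forall t, t \in S -> #|[set x | P x && (phi x == t)]|%:R <= h) ->
  #|[set x | P x]|%:R <= (size S)%:R * h.
Proof.
move=> uS phiS le_h; rewrite card_sumr (sum_fibers _ uS phiS).
rewrite -sumr_const_seq !big_seq.
by apply: ler_sum => t tS; rewrite -card_sumr le_h.
Qed.

(* Cauchy-Schwarz, obtained by expanding [sum (size S * f - #|X|)^2 >= 0]
   where [f] is the size of the fibre. *)
Lemma card_collisions (S : seq T) :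
    uniq S -> (forall x, phi x \in S) ->
  #|X|%:R ^+ 2 <= (size S)%:R * #|[set p : X * X | phi p.1 == phi p.2]|%:R :> R.
Proof.
move=> uS phiS; pose f d : R := #|[set x | phi x == d]|%:R.
have sumf : \sum_(d <- S) f d = #|X|%:R.
  rewrite -[RHS]mulr_natl mulr1 -sumr_const (sum_fibers (P := predT) _ uS) //.
  by apply: eq_bigr => d _; rewrite /f card_sumr.
have sumf2 : \sum_(d <- S) f d ^+ 2 = #|[set p : X * X | phi p.1 == phi p.2]|%:R.
  rewrite card_sumr -(pair_big_dep predT (fun x y => phi x == phi y) (fun _ _ => 1)) /=.
  rewrite (sum_fibers (P := predT) _ uS) //; apply: eq_bigr => d _ /=.
  rewrite (eq_bigr (fun=> f d)) => [|x /eqP xd].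
    by rewrite sumr_const -mulr_natl expr2; congr (_%:R * _); rewrite cardsE.
  by rewrite /f card_sumr; apply: eq_bigl => y; rewrite xd eq_sym.
have : 0 <= \sum_(d <- S) ((size S)%:R * f d - #|X|%:R) ^+ 2.
  by apply: sumr_ge0 => d _; apply: sqr_ge0.
under eq_bigr do rewrite sqrrB exprMn -mulrnAr.
rewrite big_split sumrB /= -mulr_sumr sumf2 -mulr_suml -mulr_sumr sumf sumr_const_seq.
case: (posnP (size S)) => [/size0nil S0|S0].
  have : #|X|%:R = 0 :> R by rewrite -sumf S0 big_nil.
  by move=> ->; rewrite expr0n mulr_ge0.
have k0 : 0 < (size S)%:R :> R by rewrite ltr0n.
move=> h; rewrite -(ler_pM2l k0); move: h.
by set k := (size S)%:R; set n := #|X|%:R; nra.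
Qed.

End Fibers.

(** * Popular differences in a multiset *)

Section BalogSzemerediGowers.
Variables (R : realFieldType) (G : zmodType) (X : finType) (sg : X -> G).

(** The map [sg] encodes a multiset whose multiplicity function f is the size of [fiber]. Then
    [nrep] is the autocorrelation of f, [nrep 0] is its squared L2 norm and [eadd] its additive
    energy. *)
Definition diff (p : X * X) : G := sg p.1 - sg p.2.
Definition fiber (x : G) : {set X} := [set y | sg y == x].
Definition dfiber (d : G) : {set X * X} := [set p | diff p == d].
Definition nrep (d : G) : R := #|dfiber d|%:R.
Definition eadd : R := \sum_p nrep (diff p).
Definition diffs : seq G := undup (codom diff).

Lemma diffs_uniq : uniq diffs.
Proof. exact: undup_uniq. Qed.

Lemma mem_diffs p : diff p \in diffs.
Proof. by rewrite mem_undup codom_f. Qed.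

Lemma nrep_ge0 d : 0 <= nrep d.
Proof. exact: ler0n. Qed.

Lemma nrepN d : nrep (- d) = nrep d.
Proof.
pose swap (p : X * X) := (p.2, p.1).
have swapK : involutive swap by case.
rewrite /nrep -(card_preimset (dfiber d) (inv_inj swapK)).
congr (#|pred_of_set _|%:R); apply/setP => p.
by rewrite !inE /diff /= -eqr_oppLR opprB.
Qed.

Lemma sum_nrep : \sum_(d <- diffs) nrep d = #|X|%:R ^+ 2.
Proof.
have := @sum_fibers R _ _ diff diffs predT (fun=> 1) diffs_uniq (fun p _ => mem_diffs p).
rewrite sumr_const card_prod natrM -expr2 => ->.
by apply: eq_bigr => d _; rewrite /nrep card_sumr.
Qed.

Lemma sum_nrep_sqr : \sum_(d <- diffs) nrep d ^+ 2 = eadd.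
Proof.
rewrite /eadd (@sum_fibers R _ _ diff diffs) ?diffs_uniq //; last first.
  by move=> p _; apply: mem_diffs.
apply: eq_bigr => d _; rewrite (eq_bigr (fun=> nrep d)); last by move=> p /eqP->.
by rewrite sumr_const -[RHS]mulr_natr expr2; congr (_ * _%:R); rewrite /dfiber cardsE.
Qed.

(** Double counting: for a fixed t in [D], the map u -> u - t is injective, so at most [size D]
    elements u contribute. *)
Lemma sum_count_sub (U D : seq G) : uniq U ->
  \sum_(u <- U) (count (fun t => u - t \in D) D)%:R <= (size D)%:R ^+ 2 :> R.
Proof.
move=> uU; have sum1 (S : seq G) P : (count P S)%:R = \sum_(t <- S | P t) 1 :> R.
  by rewrite big_const_seq iter_addr_0.
under eq_bigr do rewrite sum1.
rewrite (exchange_big_dep xpredT) //= expr2 -sumr_const_seq.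
apply: ler_sum => t _; rewrite -sum1 ler_nat -size_filter.
rewrite -(size_map (fun u => u - t)); apply: uniq_leq_size.
  by rewrite map_inj_uniq ?filter_uniq //; apply: addIr.
by move=> _ /mapP[u + ->]; rewrite mem_filter => /andP[].
Qed.

Section BadPairs.
Variable eta : R.

(** Inside [badpairs d] both pairs have difference [d], so first and second coordinates differ by
    the same element and either could be compared. *)
Definition bad (q z : X * X) : bool := nrep (sg q.1 - sg z.1) < eta.
Definition badpairs d : {set (X * X) * (X * X)} :=
  [set w | (diff w.1 == d) && (diff w.2 == d) && bad w.1 w.2].

Lemma bad_sym q z : bad q z = bad z q.
Proof. by rewrite /bad -nrepN opprB. Qed.

(* The quadruples [i - j = k - l] with [i - k] unpopular are also the
   quadruples [i - k = j - l] with [i - k] unpopular. *)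
Lemma sum_badpairs : 0 <= eta ->
  \sum_(d <- diffs) #|badpairs d|%:R <= eta * #|X|%:R ^+ 2.
Proof.
move=> eta0.
have -> : \sum_(d <- diffs) #|badpairs d|%:R =
    \sum_(w : (X * X) * (X * X) | (diff w.1 == diff w.2) && bad w.1 w.2) 1 :> R.
  rewrite (@sum_fibers R _ _ (fun w => diff w.1) diffs) ?diffs_uniq //; last first.
    by move=> w _; apply: mem_diffs.
  apply: eq_bigr => d _; rewrite card_sumr; apply: eq_bigl => w.
  case: (eqVneq (diff w.1) d) => [->|]; last by rewrite andbF.
  by rewrite eq_sym andbT.
pose tr (w : (X * X) * (X * X)) := ((w.1.1, w.2.1), (w.1.2, w.2.2)).
have trK : involutive tr by case=> -[? ?] [? ?].
rewrite (reindex_inj (inv_inj trK)) /=.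
rewrite (eq_bigl (fun w => (nrep (diff w.1) < eta) && (diff w.1 == diff w.2))); last first.
  case=> -[i j] [k l]; rewrite /bad /diff /= andbC; congr (_ && _).
  by rewrite !subr_eq; congr (_ == _); rewrite addrAC [RHS]addrAC [sg j + _]addrC.
rewrite -(pair_big_dep (fun p => nrep (diff p) < eta) (fun p q => diff p == diff q)
  (fun _ _ => 1)) /=.
apply: (@le_trans _ _ (\sum_(p | nrep (diff p) < eta) eta)).
  apply: ler_sum => p /ltW; apply: le_trans.
  rewrite -card_sumr ler_nat subset_leq_card //.
  by apply/subsetP => q; rewrite !inE eq_sym.
rewrite sumr_const -[leLHS]mulr_natr ler_wpM2l // -natrX ler_nat -mulnn -card_prod.
exact: max_card.
Qed.
End BadPairs.

(** If every [d] failed, then [nrep d ^+ 2] would be at most (e/4) [nrep d], or else 8 times the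
    number of bad pairs. Each alternative sums to at most (e/4) N^2, the second because 8/32 = 1/4,
    so the energy would be at most half of its lower bound. *)
Lemma exists_good_difference (e N : R) :
    0 < e -> 0 < N -> #|X|%:R <= N -> e * N ^+ 2 <= eadd ->
  exists d, e / 4%:R <= nrep d /\
            #|badpairs (e / 32%:R) d|%:R <= nrep d ^+ 2 / 8%:R.
Proof.
move=> e0 N0 XN leE.
have [/hasP[d _ /andP[? ?]]|/hasPn none] := boolP (has (fun d =>
    (e / 4%:R <= nrep d) &&
    (#|badpairs (e / 32%:R) d|%:R <= nrep d ^+ 2 / 8%:R)) diffs).
  by exists d.
have X2 : #|X|%:R ^+ 2 <= N ^+ 2 by rewrite lerXn2r ?nnegrE // ltW.
have N2 : 0 < e * N ^+ 2 by rewrite mulr_gt0 // exprn_gt0.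
have eta0 : 0 <= e / 32%:R by rewrite divr_ge0 // ltW.
have : eadd <= \sum_(d <- diffs) (e / 4%:R * nrep d +
                                  8%:R * #|badpairs (e / 32%:R) d|%:R).
  rewrite -sum_nrep_sqr !big_seq; apply: ler_sum => d /none.
  rewrite negb_and -!ltNge => /orP[lt_d|lt_d].
    rewrite expr2 (@le_trans _ _ (e / 4%:R * nrep d)) //.
      by rewrite ler_wpM2r ?nrep_ge0 // ltW.
    by rewrite lerDl mulr_ge0.
  have : 0 <= e / 4%:R * nrep d by rewrite mulr_ge0 ?nrep_ge0 ?divr_ge0 // ltW.
  by move: lt_d; set u := _%:R; lra.
rewrite big_split /= -!mulr_sumr sum_nrep => le2.
have := sum_badpairs eta0; nra.
Qed.

Lemma popular_differences_le (eta N : R) :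
    0 < eta -> #|X|%:R <= N ->
  (size [seq d <- diffs | eta <= nrep d])%:R * eta <= N ^+ 2.
Proof.
move=> eta0 XN; have X2 : #|X|%:R ^+ 2 <= N ^+ 2.
  by rewrite lerXn2r ?nnegrE // (le_trans _ XN).
apply: le_trans X2; rewrite -sum_nrep mulrC mulr_natr -iter_addr_0.
rewrite size_filter -(big_const_seq _ _ diffs (fun d => eta <= nrep d)) /=.
rewrite big_mkcond; apply: ler_sum => d _; case: ifP => // _; exact: nrep_ge0.
Qed.

(* Every difference [u] of two elements of the selected set is a sum of two
   popular differences in at least [#|dfiber d| / 2] ways. *)
Lemma balog_szemeredi_gowers (e N H : R) :
    0 < e -> 0 < N -> 0 <= H ->
    #|X|%:R <= N -> (forall x, #|fiber (sg x)|%:R <= H) ->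
    e * N ^+ 2 <= eadd ->
  exists S : {fset G},
    [/\ #|` subfs S S|%:R * e ^+ 3 <= 2 ^+ 13 * N ^+ 4 * H ^+ 2,
        e <= 8%:R * H ^+ 2 * #|` S|%:R &
        e <= 8%:R * H * #|[set x | sg x \in S]|%:R].
Proof.
move=> e0 N0 H0 XN fibH leE.
have [d [large few]] := exists_good_difference e0 N0 XN leE.
set eta := e / 32%:R in few.
have eta0 : 0 < eta by rewrite divr_gt0.
have r0 : 0 < nrep d by apply: lt_le_trans large; rewrite divr_gt0.
pose Y := dfiber d; pose badn q := #|[set z in Y | bad eta q z]|.
pose Y' := [set q in Y | (badn q)%:R <= nrep d / 4%:R].
have Y'Y : Y' \subset Y by apply/subsetP => q; rewrite inE => /andP[].
have fibH' x : #|fiber x|%:R <= H.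
  have [->|[y]] := set_0Vmem (fiber x); first by rewrite cards0.
  by rewrite inE => /eqP<-.
(* Markov: each q outside [Y'] lies in more than [nrep d / 4] bad pairs, and there are at most
   [nrep d ^+ 2 / 8] of them, so [Y'] misses at most half of [Y]. *)
have Y'large : nrep d <= 2%:R * #|Y'|%:R.
  have : #|Y :\: Y'|%:R * (nrep d / 4%:R) <= #|badpairs eta d|%:R.
    rewrite mulrC mulr_natr -sumr_const.
    apply: (@le_trans _ _ (\sum_(q in Y :\: Y') (badn q)%:R)).
      apply: ler_sum => q; rewrite !inE negb_and -ltNge => /andP[+ qY].
      by rewrite qY /= => /ltW.
    under eq_bigr do rewrite /badn card_sumr.
    rewrite pair_big_dep /= card_sumr [leRHS]big_mkcond [leLHS]big_mkcond /=.
    apply: ler_sum => -[q z] _ /=; rewrite !inE /=.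
    case: (diff q == d); case: (diff z == d); case: (bad _ q z);
      by rewrite ?andbF //=; case: ifP.
  have : #|Y|%:R = #|Y'|%:R + #|Y :\: Y'|%:R :> R.
    by rewrite -natrD -(cardsID Y' Y) (setIidPr Y'Y).
  rewrite -[#|Y|%:R]/(nrep d); nra.
pose S := [fset sg p.1 | p in Y'].
(* The value of the first coordinate forces that of the second, leaving at most [H] indices for
   each. *)
have card_le (P : pred (X * X)) (x : G) : #|[set z in Y | P z & sg z.1 == x]|%:R <= H ^+ 2.
  have sub : [set z in Y | P z & sg z.1 == x] \subset setX (fiber x) (fiber (x - d)).
    apply/subsetP => -[i j]; rewrite !inE /diff /= => /andP[/eqP<- /andP[_ /eqP<-]].
    by rewrite eqxx opprB addrC subrK eqxx.
  apply: (@le_trans _ _ (#|fiber x|%:R * #|fiber (x - d)|%:R)).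
    by rewrite -natrM -cardsX ler_nat subset_leq_card.
  by rewrite expr2 ler_pM.
exists S; split.
- pose D := [seq t <- diffs | eta <= nrep t].
  have uD : uniq D by rewrite filter_uniq ?diffs_uniq.
  have leD : (size D)%:R * eta <= N ^+ 2 by apply: popular_differences_le.
  have notbad q z : ~~ bad eta q z -> sg q.1 - sg z.1 \in D.
    by rewrite mem_filter -leNgt => -> /=; apply: (mem_diffs (q.1, z.1)).
  (* At most a quarter of [Y] is bad for q and a quarter for q'. Each remaining z splits u into the
     popular differences sg q.1 - sg z.1 and sg z.1 - sg q'.1, and at most H^2 of the z give the
     same splitting. *)
  have many u : u \in subfs S S ->
      nrep d / 2%:R <= (count (fun t => u - t \in D) D)%:R * H ^+ 2.
    case/subfsP => _ [_ [/imfsetP[q /= qY' ->] /imfsetP[q' /= q'Y' ->] ->]].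
    pose good z := ~~ bad eta q z && ~~ bad eta z q'.
    apply: (@le_trans _ _ #|[set z | (z \in Y) && good z]|%:R).
      have : (#|Y| <= #|[set z | (z \in Y) && good z]| + (badn q + badn q'))%N.
        apply: (@leq_trans #|[set z | (z \in Y) && good z] :|:
           ([set z in Y | bad eta q z] :|: [set z in Y | bad eta q' z])|).
          apply: subset_leq_card; apply/subsetP => z zY.
          rewrite !inE /good (bad_sym _ z q'); move: zY; rewrite inE => ->.
          by case: (bad _ q z); case: (bad _ q' z).
        by rewrite (leq_trans (leq_card_setU _ _).1) // leq_add2l (leq_card_setU _ _).1.
      rewrite -(ler_nat R) !natrD -[#|Y|%:R]/(nrep d).
      by move: qY' q'Y'; rewrite !inE => /andP[_ h] /andP[_ h']; lra.
    rewrite -size_filter; apply: (@card_fibers_le R _ _ (fun z => sg q.1 - sg z.1)).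
    + exact: filter_uniq.
    + move=> z /andP[zY /andP[g1 g2]]; rewrite mem_filter notbad // andbT.
      by rewrite opprB addrA addrC addrA addKr addrC notbad.
    + move=> t _; rewrite (le_trans _ (card_le good (sg q.1 - t))) // ler_nat.
      apply: subset_leq_card; apply/subsetP => z; rewrite !inE.
      move=> /andP[/andP[-> ->] /eqP <-] /=.
      by rewrite opprB addrC subrK.
  have le1 : #|` subfs S S|%:R * (nrep d / 2%:R) <= (size D)%:R ^+ 2 * H ^+ 2.
    have cnt := sum_count_sub D (fset_uniq (subfs S S)).
    rewrite -sumr_const_seq (le_trans _ (ler_wpM2r (exprn_ge0 2 H0) cnt)) //.
    by rewrite mulr_suml !big_seq; apply: ler_sum => u; apply: many.
  have le2 : #|` subfs S S|%:R * (e / 8%:R) <= (size D)%:R ^+ 2 * H ^+ 2.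
    apply: le_trans le1; rewrite ler_wpM2l //; lra.
  have D2 : ((size D)%:R * eta) ^+ 2 <= (N ^+ 2) ^+ 2.
    apply: lerXn2r leD; rewrite nnegrE.
      by apply: mulr_ge0; [apply: ler0n | apply: ltW].
    by apply: exprn_ge0; apply: ltW.
  (* Multiplying by eta^2 = e^2 / 2^10 makes [D2] applicable; with the factor 8 of [le2] this yields
     2^13. *)
  have := ler_wpM2r (exprn_ge0 2 (ltW eta0)) le2.
  have := ler_wpM2r (exprn_ge0 2 H0) D2.
  by rewrite /eta; lra.
- have h : #|Y'|%:R <= #|` S|%:R * H ^+ 2.
    have := @card_fibers_le R _ _ (fun p => sg p.1) S (fun p => p \in Y') (H ^+ 2).
    rewrite fset_uniq cardsE; apply=> //.
      by move=> x xY'; apply/imfsetP; exists x.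
    move=> t _; rewrite (le_trans _ (card_le (mem Y') t)) // ler_nat.
    apply: subset_leq_card; apply/subsetP => z; rewrite !inE.
    by move=> /andP[/andP[-> ->] ->].
  nra.
(* Here the first coordinate itself is fixed and not just its value, so only the second is free and
   a single [H] is lost. *)
- have h : #|Y'|%:R <= #|[set x | sg x \in S]|%:R * H.
    have := @card_fibers_le R _ _ fst (enum [set x | sg x \in S]) (fun p => p \in Y') H.
    rewrite enum_uniq -cardE [#|[set x | x \in Y']|]cardsE; apply=> //.
      by move=> x xY'; rewrite mem_enum inE; apply/imfsetP; exists x.
    move=> x _; rewrite (le_trans _ (fibH' (sg x - d))) // ler_nat.
    rewrite -(card_in_imset (f := snd)).
      apply: subset_leq_card; apply/subsetP => j /imsetP[[i k]].
      rewrite !inE /diff /= => /andP[/andP[/eqP<- _] /eqP<-] ->.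
      by rewrite opprB addrC subrK.
    by move=> [i j] [i' j']; rewrite !inE /= => /andP[_ /eqP->] /andP[_ /eqP->] ->.
  nra.
Qed.

End BalogSzemerediGowers.

(** * Discarding the values of large multiplicity *)

Section Truncation.
Variables (R : realFieldType) (G : zmodType).

Section Representations.
Variables (X : finType) (sg : X -> G).

Lemma sum_fiber_sqr (S : seq G) : uniq S ->
  \sum_(v <- S) #|fiber sg v|%:R ^+ 2 <= nrep R sg 0.
Proof.
move=> uS; rewrite /nrep /dfiber card_sumr.
apply: (@le_trans _ _ (\sum_(p : X * X | (sg p.1 == sg p.2) && (sg p.1 \in S)) 1)).
  rewrite (@sum_fibers R _ _ (fun p => sg p.1) S) //; last by move=> p /andP[].
  rewrite !big_seq; apply: ler_sum => v vS.
  rewrite -card_sumr -natrX -mulnn -cardsX ler_nat subset_leq_card //.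
  apply/subsetP => -[i j]; rewrite !inE /= => /andP[/eqP-> /eqP->].
  by rewrite eqxx vS.
rewrite big_mkcond [leRHS]big_mkcond; apply: ler_sum => p _.
by rewrite /diff subr_eq0; case: eqP => //= _; case: ifP.
Qed.

(** An autocorrelation is largest at 0, since 2 f(v) f(v - d) <= f(v)^2 + f(v - d)^2;
    [sum_fiber_sqr] bounds the sum of either square. *)
Lemma nrep_le0 d : nrep R sg d <= nrep R sg 0.
Proof.
pose S := undup (codom sg); have uS : uniq S by apply: undup_uniq.
pose f v : R := #|fiber sg v|%:R.
have -> : nrep R sg d = \sum_(v <- S) f v * f (v - d).
  rewrite /nrep /dfiber card_sumr (@sum_fibers R _ _ (fun p => sg p.1) S) //.
    apply: eq_bigr => v _; rewrite -card_sumr /f -natrM -cardsX; congr (_%:R).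
    apply: eq_card => -[i j]; rewrite !inE /diff /= andbC.
    case: (eqVneq (sg i) v) => //= ->.
    by apply/eqP/eqP => [<-|->]; rewrite opprB addrC subrK.
  by move=> p _; rewrite mem_undup codom_f.
have le1 := sum_fiber_sqr uS.
have : uniq [seq v - d | v <- S] by rewrite map_inj_uniq //; apply: addIr.
move=> /sum_fiber_sqr; rewrite big_map => le2.
apply: (@le_trans _ _ (\sum_(v <- S) (f v ^+ 2 + f (v - d) ^+ 2) / 2%:R)).
  apply: ler_sum => v _; have := sqr_ge0 (f v - f (v - d)); nra.
rewrite -mulr_suml big_split /=; move: le1 le2; rewrite -/f; lra.
Qed.

Lemma eadd_card : eadd R sg =
  #|[set w : (X * X) * (X * X) | diff sg w.1 == diff sg w.2]|%:R.
Proof.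
rewrite card_sumr -(pair_big_dep predT (fun p q => diff sg p == diff sg q)
  (fun _ _ => 1)) /=.
apply: eq_bigr => p _; rewrite /nrep /dfiber card_sumr.
by apply: eq_bigl => q; rewrite eq_sym.
Qed.

End Representations.

(** A lost quadruple has an entry outside [P] in one of 4 positions. That entry and its partner are
    chosen freely, and by [nrep_le0] the other pair can then be chosen in at most [nrep 0] ways. *)
Lemma eadd_restrict (X : finType) (sg : X -> G) (P : pred X) :
  eadd R sg <= eadd R (fun x : {x | P x} => sg (val x)) +
    4%:R * (#|[set x | ~~ P x]|%:R * #|X|%:R * nrep R sg 0).
Proof.
pose P2 (p : X * X) := P p.1 && P p.2.
pose E := [set w : (X * X) * (X * X) | diff sg w.1 == diff sg w.2].
pose E1 := [set w in E | ~~ P2 w.1]; pose E2 := [set w in E | ~~ P2 w.2].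
pose E0 := [set w in E | P2 w.1 && P2 w.2].
have leE : (#|E| <= #|E0| + (#|E1| + #|E2|))%N.
  apply: (@leq_trans #|E0 :|: (E1 :|: E2)|).
    apply/subset_leq_card/subsetP => w; rewrite !inE => ->.
    by case: (P2 _); case: (P2 _).
  by rewrite (leq_trans (leq_card_setU _ _).1) // leq_add2l (leq_card_setU _ _).1.
have cardP2 : (#|[set p | ~~ P2 p]| <= #|[set x | ~~ P x]| * #|X| * 2)%N.
  apply: (@leq_trans #|setX [set x | ~~ P x] setT :|: setX setT [set x | ~~ P x]|).
    apply/subset_leq_card/subsetP => -[i j]; rewrite !inE /P2 /= negb_and.
    by rewrite andbT.
  rewrite (leq_trans (leq_card_setU _ _).1) // !cardsX cardsT; lia.
have leE1 : #|E1|%:R <= 2%:R * (#|[set x | ~~ P x]|%:R * #|X|%:R * nrep R sg 0).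
  rewrite card_sumr.
  rewrite (eq_bigl (fun w => ~~ P2 w.1 && (diff sg w.1 == diff sg w.2))); last first.
    by move=> w; rewrite inE andbC.
  rewrite -(pair_big_dep (fun p => ~~ P2 p) (fun p q => diff sg p == diff sg q)
    (fun _ _ => 1)) /=.
  apply: (@le_trans _ _ (\sum_(p | ~~ P2 p) nrep R sg 0)).
    apply: ler_sum => p _; apply: le_trans (nrep_le0 sg (diff sg p)).
    by rewrite /nrep /dfiber card_sumr; under [leRHS]eq_bigl do rewrite eq_sym.
  rewrite sumr_const -[leLHS]mulr_natl mulrA ler_wpM2r ?nrep_ge0 //.
  by rewrite mulrC -!natrM ler_nat (leq_trans _ cardP2) // cardsE leqnn.
have E21 : #|E2| = #|E1|.
  pose swap (w : (X * X) * (X * X)) := (w.2, w.1).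
  have swapK : involutive swap by case.
  rewrite -(card_preimset E1 (inv_inj swapK)); apply: eq_card => w.
  by rewrite !inE /= eq_sym.
have leE0 : #|E0|%:R <= eadd R (fun x : {x | P x} => sg (val x)).
  rewrite eadd_card ler_nat; set E' := [set w | _].
  pose v (p : {x | P x} * {x | P x}) := (val p.1, val p.2).
  apply: leq_trans (leq_imset_card (fun w => (v w.1, v w.2)) E').
  apply/subset_leq_card/subsetP => -[[i j] [k l]]; rewrite !inE /P2 /=.
  case/andP=> e /andP[/andP[Pi Pj] /andP[Pk Pl]]; apply/imsetP.
  by exists ((Sub i Pi, Sub j Pj), (Sub k Pk, Sub l Pl)); rewrite // inE.
by rewrite (eadd_card sg) -/E; move: leE; rewrite -(ler_nat R) !natrD E21; lra.
Qed.

Lemma bsg_multiset (X : finType) (sg : X -> G) (M : R) :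
    1 <= M -> (0 < #|X|)%N ->
    #|X|%:R ^+ 2 * nrep R sg 0 / M <= eadd R sg ->
  exists S : {fset G},
    [/\ #|` subfs S S|%:R * nrep R sg 0 <= 2 ^+ 22 * M ^+ 5 * #|X|%:R ^+ 2,
        #|` subfs S S|%:R <= 2 ^+ 32 * M ^+ 8 * #|` S|%:R &
        #|X|%:R <= 128%:R * M ^+ 2 * #|[set x | sg x \in S]|%:R].
Proof.
move=> M1 X0 hE; set n : R := #|X|%:R in hE *; set F := nrep R sg 0 in hE *.
have n0 : 0 < n by rewrite ltr0n.
have M0 : 0 < M by lra.
have F0 : 0 < F.
  rewrite ltr0n card_gt0; apply/set0Pn; case/card_gt0P: X0 => x _.
  by exists (x, x); rewrite inE /diff subrr.
(* With this [H] at most F / H = n / (8M) indices are discarded, which costs energy at most n^2 F /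
   (2M), half of the hypothesis; [e] records the other half. *)
pose H := 8%:R * M * F / n; pose e := F / (2%:R * M).
have H0 : 0 < H by rewrite divr_gt0 // !mulr_gt0.
have e0 : 0 < e by rewrite divr_gt0 // mulr_gt0.
pose P x := #|fiber sg (sg x)|%:R <= H.
pose sg' (x : {x | P x}) := sg (val x).
have few : #|[set x | ~~ P x]|%:R * H <= F.
  rewrite mulr_natl -sumr_const.
  have -> : F = \sum_x #|fiber sg (sg x)|%:R.
    rewrite /F /nrep /dfiber card_sumr.
    rewrite -(pair_big_dep predT (fun i j => diff sg (i, j) == 0) (fun _ _ => 1)) /=.
    apply: eq_bigr => x _; rewrite card_sumr; apply: eq_bigl => y.
    by rewrite subr_eq0 eq_sym.
  rewrite big_mkcond; apply: ler_sum => x _; rewrite inE.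
  by case: ifP => // /negPf; rewrite /P leNgt => /negbFE/ltW.
have card' : #|{: {x | P x}}|%:R <= n by rewrite ler_nat card_sig max_card.
have fib' x : #|fiber sg' (sg' x)|%:R <= H.
  apply: le_trans (valP x); rewrite ler_nat -(card_imset _ val_inj).
  apply/subset_leq_card/subsetP => y /imsetP[z + ->].
  by rewrite !inE.
have E' : e * n ^+ 2 <= eadd R sg'.
  have := eadd_restrict sg P; rewrite -/n -/F => le1.
  have : #|[set x | ~~ P x]|%:R <= n / (8%:R * M).
    rewrite -(ler_pM2r H0) (le_trans few) // /H.
    by rewrite le_eqVlt; apply/orP; left; apply/eqP; field; lra.
  rewrite -(ler_pM2r (mulr_gt0 n0 F0)) mulrA => le2.
  have : n / (8%:R * M) * (n * F) = n ^+ 2 * F / M / 8%:R by field; lra.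
  have : e * n ^+ 2 = n ^+ 2 * F / M / 2%:R by rewrite /e; field; lra.
  by move: le1 le2 hE; lra.
have [S [le1 le2 le3]] := balog_szemeredi_gowers e0 n0 (ltW H0) card' fib' E'.
have le4 : #|` subfs S S|%:R * F <= 2 ^+ 22 * M ^+ 5 * n ^+ 2.
  (* This multiplier turns e^3 into [F]. *)
  have c0 : 0 <= 8%:R * M ^+ 3 / F ^+ 2.
    by rewrite divr_ge0 ?mulr_ge0 ?exprn_ge0 ?ltW.
  have := ler_wpM2r c0 le1; rewrite /H /e.
  set D := #|` _|%:R.
  have -> : D * (F / (2%:R * M)) ^+ 3 * (8%:R * M ^+ 3 / F ^+ 2) = D * F.
    by field; lra.
  have -> : 2 ^+ 13 * n ^+ 4 * (8%:R * M * F / n) ^+ 2 * (8%:R * M ^+ 3 / F ^+ 2) =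
     2 ^+ 22 * M ^+ 5 * n ^+ 2 by field; lra.
  by [].
exists S; split=> //.
- have le5 : n ^+ 2 <= 2 ^+ 10 * M ^+ 3 * F * #|` S|%:R.
    have c0 : 0 <= 2%:R * M * n ^+ 2 / F.
      by rewrite divr_ge0 ?mulr_ge0 ?exprn_ge0 ?ltW.
    have := ler_wpM2r c0 le2; rewrite /H /e; set s := #|` S|%:R.
    have -> : F / (2%:R * M) * (2%:R * M * n ^+ 2 / F) = n ^+ 2 by field; lra.
    have -> : 8%:R * (8%:R * M * F / n) ^+ 2 * s * (2%:R * M * n ^+ 2 / F) =
      2 ^+ 10 * M ^+ 3 * F * s by field; lra.
    by [].
  rewrite -(ler_pM2r F0) (le_trans le4) //.
  have c0 : 0 <= 2 ^+ 22 * M ^+ 5 by rewrite mulr_ge0 ?exprn_ge0 ?ltW.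
  apply: (le_trans (ler_wpM2l c0 le5)).
  by rewrite le_eqVlt; apply/orP; left; apply/eqP; ring.
- have le6 : n <= 128%:R * M ^+ 2 * #|[set x | sg' x \in S]|%:R.
    have c0 : 0 <= 2%:R * M * n / F by rewrite divr_ge0 ?mulr_ge0 ?ltW.
    have := ler_wpM2r c0 le3; rewrite /H /e; set s := #|_|%:R.
    have -> : F / (2%:R * M) * (2%:R * M * n / F) = n by field; lra.
    have -> : 8%:R * (8%:R * M * F / n) * s * (2%:R * M * n / F) =
      128%:R * M ^+ 2 * s by field; lra.
    by [].
  apply: (le_trans le6); rewrite ler_wpM2l ?mulr_ge0 ?exprn_ge0 ?(ltW M0) //.
  rewrite ler_nat -(card_imset _ val_inj).
  by apply/subset_leq_card/subsetP => y /imsetP[z + ->]; rewrite !inE.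
Qed.

End Truncation.

(** * Tuple sums *)

Section Tuples.
Variables (R : realFieldType) (G : zmodType).
Implicit Types A S : {fset G}.

Lemma nrep_tsum0 k A : nrep R (@tsum G A k) 0 = (Tk k A)%:R.
Proof.
by congr (_%:R); apply: eq_card => p; rewrite !inE subr_eq0.
Qed.

Lemma card_tuple_fset k A : #|{: k.-tuple A}| = (#|` A| ^ k)%N.
Proof. by rewrite card_tuple cardfE. Qed.

Lemma tsum_cons k A (a : A) (t : k.-tuple A) :
  tsum [tuple of a :: t] = val a + tsum t.
Proof.
by rewrite /tsum big_ord_recl tnth0; under eq_bigr do rewrite tnthS.
Qed.

(** Splitting both tuples into halves, l + r = l' + r' is rearranged injectively to l - l' = r' -
    r. *)
Lemma Tk_double_le k A : (Tk (k + k) A)%:R <= eadd R (@tsum G A k).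
Proof.
pose l (t : (k + k).-tuple A) := [tuple tnth t (lshift k i) | i < k].
pose r (t : (k + k).-tuple A) := [tuple tnth t (rshift k i) | i < k].
have tsumE t : tsum t = tsum (l t) + tsum (r t).
  rewrite /tsum big_split_ord /=.
  by congr (_ + _); apply: eq_bigr => i _; rewrite tnth_mktuple.
have lr_inj t u : l t = l u -> r t = r u -> t = u.
  move=> el er; apply: eq_from_tnth => i; rewrite -(splitK i).
  case: (split i) => j /=.
    by have := congr1 (fun w => tnth w j) el; rewrite !tnth_mktuple.
  by have := congr1 (fun w => tnth w j) er; rewrite !tnth_mktuple.
pose f (p : (k + k).-tuple A * (k + k).-tuple A) :=
  ((l p.1, l p.2), (r p.2, r p.1)).
have f_inj : injective f.
  move=> [t u] [t' u'] /eqP; rewrite !xpair_eqE /=.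
  move=> /andP[/andP[/eqP elt /eqP elu] /andP[/eqP eru /eqP ert]].
  by rewrite (lr_inj _ _ elt ert) (lr_inj _ _ elu eru).
rewrite eadd_card ler_nat /Tk -(card_imset _ f_inj).
apply/subset_leq_card/subsetP => _ /imsetP[[t u] + ->].
rewrite !inE /diff /= !tsumE => /eqP e.
by rewrite subr_eq addrAC -subr_eq opprK [_ + tsum (l u)]addrC e.
Qed.

(* Averaging over the last [k] coordinates of the tuple. *)
Lemma popular_translate k A S :
  exists2 A', A' `<=` A & exists2 c, (forall a, a \in A' -> a + c \in S) &
    #|[set t : k.+1.-tuple A | tsum t \in S]|%:R <= #|` A|%:R ^+ k * #|` A'|%:R :> R.
Proof.
pose g (u : k.-tuple A) := #|[set a : A | val a + tsum u \in S]|.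
case: (pickP {: k.-tuple A}) => [u0 _|none]; last first.
  (* Without [k]-tuples there are no [k.+1]-tuples either, so the count to be bounded is 0. *)
  exists fset0; first exact: fsub0set.
  exists 0 => //; rewrite cardfs0 mulr0 lern0 cards_eq0.
  by apply/eqP/setP => t; have := none (behead_tuple t).
case: (@arg_maxnP _ u0 predT g) => // u _ umax.
exists [fset val a | a in [set a : A | val a + tsum u \in S]].
  by apply/fsubsetP => _ /imfsetP[a _ ->]; apply: valP.
exists (tsum u) => [_ /imfsetP[a /= + ->]|]; first by rewrite inE.
rewrite card_imfset /=; last exact: val_inj.
rewrite -natrX -card_tuple_fset [#|_| in X in _ <= X * _]cardE.
apply: (@card_fibers_le R _ _ (fun t : k.+1.-tuple A => behead_tuple t)).
- exact: enum_uniq.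
- by move=> t _; rewrite mem_enum.
move=> v _; rewrite -cardE ler_nat (leq_trans _ (umax v isT)) //.
have beheadE (b : A) (t : k.-tuple A) : behead_tuple [tuple of b :: t] = t.
  exact: val_inj.
rewrite -(card_in_imset (f := @thead _ _)).
  apply/subset_leq_card/subsetP => a /imsetP[t].
  case/tupleP: t => b t; rewrite !inE theadE tsum_cons beheadE.
  by move=> /andP[+ /eqP <-] ->.
move=> t t'; case/tupleP: t => b t; case/tupleP: t' => b' t'.
by rewrite !inE !theadE !beheadE => /andP[_ /eqP->] /andP[_ /eqP->] ->.
Qed.

Lemma card_subfs_ge S : (#|` S| <= #|` subfs S S|)%N.
Proof.
case: (fset_0Vmem S) => [->|[x xS]]; first by rewrite cardfs0.
rewrite -(card_shift (- x)); apply: fsubset_leq_card; apply/fsubsetP => y.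
rewrite mem_shift opprK => yS; apply/subfsP; exists (y + x), x.
by rewrite addrK.
Qed.

(** Balog-Szemerédi-Gowers is applied to the multiset of [k.+1]-fold sums; one coordinate is split
    off by [popular_translate] to bring the structured set back to [A]. *)
Lemma small_sumsets_of_large_Tk k A (M : R) :
    1 <= M -> A != fset0 ->
    #|` A|%:R ^+ (2 * k.+1) * (Tk k.+1 A)%:R / M <= (Tk (2 * k.+1) A)%:R ->
  exists2 A', A' `<=` A &
    #|` A|%:R <= 128%:R * M ^+ 2 * #|` A'|%:R /\
    forall n m, #|` sumdiff n m A'|%:R * (Tk k.+1 A)%:R <=
      (2 ^+ 32 * M ^+ 8) ^+ (n + m) * (2 ^+ 22 * M ^+ 5 * #|` A|%:R ^+ (2 * k.+1)).
Proof.
move=> M1 A0 hT; have a0 : 0 < #|` A|%:R :> R by rewrite ltr0n cardfs_gt0.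
have X0 : (0 < #|{: k.+1.-tuple A}|)%N.
  by rewrite card_tuple_fset expn_gt0 cardfs_gt0 A0.
have X2 : #|{: k.+1.-tuple A}|%:R ^+ 2 = #|` A|%:R ^+ (2 * k.+1) :> R.
  by rewrite card_tuple_fset natrX -exprM mulnC.
have hE : #|{: k.+1.-tuple A}|%:R ^+ 2 * nrep R (@tsum G A k.+1) 0 / M <=
          eadd R (@tsum G A k.+1).
  rewrite X2 nrep_tsum0 (le_trans hT) // mul2n -addnn; exact: Tk_double_le.
have [S [le1 le2 le3]] := bsg_multiset M1 X0 hE.
have [A' sub [c tr leA']] := popular_translate k A S.
have le4 : #|` A|%:R <= 128%:R * M ^+ 2 * #|` A'|%:R.
  have ak0 : 0 < #|` A|%:R ^+ k :> R by rewrite exprn_gt0.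
  have c0 : 0 <= 128%:R * M ^+ 2 by rewrite mulr_ge0 ?exprn_ge0 //; lra.
  rewrite -(ler_pM2l ak0) -exprSr -[leLHS]natrX -card_tuple_fset.
  apply: (le_trans le3); apply: (le_trans (ler_wpM2l c0 leA')).
  by rewrite le_eqVlt; apply/orP; left; apply/eqP; ring.
exists A' => //; split=> // n m.
have S0 : S != fset0.
  apply: contraL a0 => /eqP S0; rewrite -leNgt (le_trans le4) //.
  have -> : A' = fset0.
    by apply/fsetP => x; apply/idP => /tr; rewrite S0 in_fset0.
  by rewrite cardfs0 mulr0.
(* Since A' + c ⊆ S, the set A' - S lies in a translate of S - S, so -S grows little when [A'] is
   added. *)
pose Q := [fset - x | x in S].
have cardQ : #|` Q| = #|` S| by rewrite card_imfset //=; apply: oppr_inj.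
have Q0 : Q != fset0 by rewrite -cardfs_gt0 cardQ cardfs_gt0.
have QA' : #|` addfs Q A'|%:R <= 2 ^+ 32 * M ^+ 8 * #|` Q|%:R.
  rewrite cardQ (le_trans _ le2) // ler_nat -(card_shift (- c) (subfs S S)).
  apply: fsubset_leq_card; apply/fsubsetP => _ /addfsP[_ [a [/imfsetP[x /= xS ->] aA' ->]]].
  rewrite mem_shift opprK; apply/subfsP; exists (a + c), x; split=> //; first exact: tr.
  by rewrite -addrA addrC.
have := plunnecke_ruzsa n m Q0 QA'; rewrite cardQ => le5.
have T0 : 0 <= (Tk k.+1 A)%:R :> R by [].
have k0 : 0 <= 2 ^+ 32 * M ^+ 8 by rewrite mulr_ge0 ?exprn_ge0 //; lra.
apply: (le_trans (ler_wpM2r T0 le5)); rewrite -[leLHS]mulrA.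
apply: ler_wpM2l; first exact: exprn_ge0.
(* The factor |Q| = |S| left by Plünnecke is at most |S - S|, whose product with T is bounded by
   [le1]. *)
rewrite -X2; apply: le_trans le1; rewrite nrep_tsum0; apply: ler_wpM2r => //.
by rewrite ler_nat card_subfs_ge.
Qed.

Lemma Tk_mono k A A' : A' `<=` A -> (Tk k A' <= Tk k A)%N.
Proof.
move=> sub; pose inc (t : k.-tuple A') := [tuple fincl sub (tnth t i) | i < k].
have tsum_inc t : tsum (inc t) = tsum t.
  by apply: eq_bigr => i _; rewrite tnth_mktuple.
have inc_inj : injective inc.
  move=> t u e; apply: eq_from_tnth => i.
  have := congr1 (fun w => tnth w i) e; rewrite !tnth_mktuple.
  by move=> /(congr1 val) /= /val_inj.
have f_inj : injective (fun p => (inc p.1, inc p.2)).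
  move=> [t u] [t' u'] /eqP; rewrite xpair_eqE !(inj_eq inc_inj) -xpair_eqE.
  by move/eqP.
rewrite /Tk -(card_imset _ f_inj).
apply/subset_leq_card/subsetP => _ /imsetP[p + ->].
by rewrite !inE /= !tsum_inc.
Qed.

Lemma Tk_gt0 k A : A != fset0 -> (0 < Tk k A)%N.
Proof.
case/fset0Pn => a aA; rewrite card_gt0; apply/set0Pn.
by exists ([tuple [` aA] | i < k], [tuple [` aA] | i < k]); rewrite inE.
Qed.

Lemma Tk_le k A : (Tk k A <= #|` A| ^ (2 * k))%N.
Proof.
by rewrite /Tk (leq_trans (max_card _)) // card_prod card_tuple_fset -expnD addnn mul2n.
Qed.

(** Cauchy-Schwarz over the values of [k]-fold sums. They are translated by a fixed element of [A]
    into kA - A, as the bounds of (ii) concern only positive m. *)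
Lemma Tk_sumdiff_ge k A : A != fset0 ->
  #|` A|%:R ^+ (2 * k) <= #|` sumdiff k 1 A|%:R * (Tk k A)%:R :> R.
Proof.
case/fset0Pn => a aA.
have := @card_collisions R _ _ (fun t : k.-tuple A => tsum t - a)
  (sumdiff k 1 A) (fset_uniq _).
rewrite card_tuple_fset natrX -exprM mulnC => h; apply: (le_trans (h _)).
  move=> t; apply/imfsetP; exists (t, [tuple [` aA]]); first by rewrite inE.
  by congr (_ - _); rewrite /tsum big_ord1.
rewrite ler_wpM2l // ler_nat subset_leq_card //.
by apply/subsetP => p; rewrite !inE (inj_eq (addIr _)).
Qed.

Lemma energyE A : energy A = Tk 2 A.
Proof.
pose f (p : (A * A) * (A * A)) := ([tuple p.1.1; p.2.2], [tuple p.2.1; p.1.2]).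
have f_inj : injective f by move=> [[a b] [c d]] [[a' b'] [c' d']] [-> -> -> ->].
rewrite /energy -(card_imset _ f_inj); apply: eq_card => -[t u].
have tsum2 (a b : A) : tsum [tuple a; b] = val a + val b.
  by rewrite /tsum big_ord_recl big_ord1.
apply/imsetP/idP => [[[[a b] [c d]]]|].
  rewrite inE /= => e [-> ->]; rewrite inE /= !tsum2.
  by move: e; rewrite subr_eq addrAC eq_sym subr_eq eq_sym.
case/tupleP: t => a t; case/tupleP: t => d t; case/tupleP: u => c u; case/tupleP: u => b u.
rewrite (tuple0 t) (tuple0 u) => e; exists ((a, b), (c, d)) => //.
move: e; rewrite !inE /=.
have -> : [tuple of a :: [tuple of d :: [tuple]]] = [tuple a; d] by apply: val_inj.
have -> : [tuple of c :: [tuple of b :: [tuple]]] = [tuple c; b] by apply: val_inj.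
by rewrite !tsum2 => e; rewrite subr_eq addrAC eq_sym subr_eq eq_sym.
Qed.

End Tuples.

(** * Bounds in terms of the logarithm *)

Lemma ln2_gt0 : 0 < ln (2 : RR).
Proof. by apply: ln_gt0; lra. Qed.

Lemma log2_ge (j n : nat) : (2 ^ j <= n)%N -> j%:R <= log2 n%:R.
Proof.
move=> le_n; have n0 : (0 < n)%N by rewrite (leq_trans _ le_n) // expn_gt0.
rewrite /log2 ler_pdivlMr ?ln2_gt0 // mulr_natl -lnXn; last by lra.
by rewrite ler_ln ?posrE ?exprn_gt0 ?ltr0n // -natrX ler_nat.
Qed.

(** The case n = 0 rests on the convention that [ln] vanishes at 0. *)
Lemma log2_le1 (n : nat) : (n <= 1)%N -> log2 n%:R = 0.
Proof.
by case: n => [|[|//]] _; rewrite /log2 ?ln1 ?(ln0 (lexx 0)) ?mul0r.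
Qed.

Section DegenerateSumsets.
Variable G : zmodType.

Lemma sumdiff0 n m : (0 < n)%N -> sumdiff n m (fset0 : {fset G}) = fset0.
Proof.
move=> n0; apply/fsetP => x; rewrite in_fset0; apply/imfsetP => -[[t u] _ _].
by have := valP (tnth t (Ordinal n0)); rewrite in_fset0.
Qed.

Lemma card_sumdiff1 n m (x : G) : (#|` sumdiff n m [fset x]| <= 1)%N.
Proof.
have tsumE k (t : k.-tuple [fset x]) : tsum t = x *+ k.
  rewrite /tsum (eq_bigr (fun=> x)) ?sumr_const ?card_ord // => i _.
  by have := valP (tnth t i); rewrite in_fset1 => /eqP.
rewrite -(cardfs1 (x *+ n - x *+ m)); apply: fsubset_leq_card.
by apply/fsubsetP => y /imfsetP[[t u] _ ->]; rewrite !tsumE in_fset1.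
Qed.

End DegenerateSumsets.

(* If [|A| <= 1] then [log2 |A| = 0] and only the empty set works.  If
   [|A| < 16] a single point does.  Otherwise [(log2 |A|)^16 >= 2^32], which
   absorbs the constant [2^32] raised to the power [n + m]. *)
Lemma structured_subset (s : nat) (G : zmodType) (A : {fset G}) (M : RR) :
    (2 <= s)%N -> 1 <= M ->
    #|` A|%:R ^+ (2 * s) * (Tk s A)%:R / M <= (Tk (2 * s) A)%:R ->
  exists A' : {fset G}, A' `<=` A /\
    (128%:R^-1 * #|` A|%:R / (M ^+ 3 * log2 #|` A|%:R `^ (16%:R / 3%:R))
       <= #|` A'|%:R) /\
    (forall n m : nat, (0 < n)%N -> (0 < m)%N ->
      #|` sumdiff n m A'|%:R <=
        2 ^+ 29 * (M ^+ 3 * log2 #|` A|%:R ^+ 4) ^+ (4 * (n + m))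
          * M * #|` A'|%:R * (#|` A|%:R ^+ (2 * s - 1) / (Tk s A)%:R)).
Proof.
case: s => // k k1 M1 hT; set L := log2 _; set a : RR := #|` A|%:R.
have [a1|a2] := leqP #|` A| 1.
  exists fset0; split; first exact: fsub0set.
  (* As [L] is 0 and the inverse of 0 is 0, the required lower bound for |A'| is 0. *)
  split=> [|n m n0 _]; last by rewrite sumdiff0 // cardfs0 mulr0 mul0r.
  rewrite /L log2_le1 // powR0 ?mulr0 ?invr0 ?mulr0 //.
  by rewrite mulf_neq0 ?invr_eq0 ?pnatr_eq0.
have A0 : A != fset0 by rewrite -cardfs_gt0 ltnW.
have a0 : 0 < a by rewrite ltr0n ltnW.
have T0 : 0 < (Tk k.+1 A)%:R :> RR by rewrite ltr0n Tk_gt0.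
have L1 : 1 <= L by apply: (@log2_ge 1).
have logpow : 1 <= L `^ (16%:R / 3%:R).
  by rewrite (le_trans L1) // le1r_powR //; lra.
have M3 : 1 <= M ^+ 3 by rewrite exprn_ege1.
have M3L : 1 <= M ^+ 3 * L `^ (16%:R / 3%:R) by nra.
have aE : a ^+ (2 * k.+1) = a ^+ (2 * k.+1 - 1) * a.
  by rewrite -exprSr; congr (_ ^+ _); lia.
have p0 : 0 < a ^+ (2 * k.+1 - 1) by rewrite exprn_gt0.
have [a16|a16] := ltnP #|` A| 16.
  have [x xA] := fset0Pn _ A0.
  exists [fset x]; split; first by rewrite fsub1set.
  rewrite cardfs1; split=> [|n m _ _].
    rewrite ler_pdivrMr; last by lra.
    have : a <= 16%:R by rewrite ler_nat ltnW.
    lra.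
  apply: (@le_trans _ _ 1); first by rewrite lern1 card_sumdiff1.
  have le1 : 1 <= (M ^+ 3 * L ^+ 4) ^+ (4 * (n + m)).
    rewrite exprn_ege1 //; have : 1 <= L ^+ 4 by rewrite exprn_ege1.
    nra.
  (* The trivial bound T <= a^(2s) together with a <= 16; the constant 16 is covered by 2^29. *)
  have le2 : 1 <= 16%:R * (a ^+ (2 * k.+1 - 1) / (Tk k.+1 A)%:R).
    rewrite mulrA ler_pdivlMr // mul1r (@le_trans _ _ (a ^+ (2 * k.+1))) //.
      by rewrite -natrX ler_nat Tk_le.
    rewrite aE [leLHS]mulrC ler_pM2r //.
    by rewrite ler_nat ltnW.
  move: le1 le2; set u := _ ^+ _; set v := _ / _ => le1 le2.
  have : 1 <= u * M by nra.
  nra.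
have [A' sub [le1 le2]] := small_sumsets_of_large_Tk M1 A0 hT.
exists A'; split=> //; split=> [|n m n0 m0].
  rewrite ler_pdivrMr; last by lra.
  rewrite mulrC ler_pdivrMr // (le_trans le1) //.
  have : M ^+ 2 <= M ^+ 3 * L `^ (16%:R / 3%:R).
    have : M ^+ 2 <= M ^+ 3 by rewrite ler_weXn2l.
    nra.
  have : 0 <= #|` A'|%:R :> RR by [].
  nra.
have L4 : 4%:R <= L by apply: (@log2_ge 4).
set q := (n + m)%N; have q2 : (2 <= q)%N by apply: (@leq_add 1 1).
have M0 : 0 <= M by lra.
have L0 : 0 <= L by lra.
have := le2 n m; rewrite -/q -/a aE.
(* The 2^22 comes from the sumset bound, the 128 from trading one factor |A| for |A'| through
   [le1]. *)
have -> : 2 ^+ 29 = 128%:R * 2 ^+ 22 :> RR by rewrite (exprD 2 7 22); congr (_ * _); ring.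
have KL : 2 ^+ 32 <= L ^+ 16.
  have -> : 2 ^+ 32 = 4%:R ^+ 16 :> RR by rewrite (exprM 2 2 16); congr (_ ^+ _); ring.
  by apply: lerXn2r => //; rewrite nnegrE.
have : 0 <= 2 ^+ 32 :> RR by apply: exprn_ge0.
have : 0 <= 2 ^+ 22 :> RR by apply: exprn_ge0.
move: (2 ^+ 32) (2 ^+ 22) KL => K J KL J0 K0 le3.
(* The surplus M^6 is M^5 from the sumset bound times M^2 from [le1], less the factor [M] of the
   target. It fits into M^(4q) because q >= 2, and 8 + 4 = 12 matches (M^3)^4. *)
have le4 : (K * M ^+ 8) ^+ q * M ^+ 6 <= (M ^+ 3 * L ^+ 4) ^+ (4 * q).
  apply: (@le_trans _ _ ((K * M ^+ 8) ^+ q * (M ^+ 4) ^+ q)).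
    apply: ler_wpM2l; first by rewrite exprn_ge0 // mulr_ge0 // exprn_ge0.
    by rewrite -exprM ler_weXn2l // (@leq_trans (4 * 2)) // leq_pmul2l.
  rewrite -exprMn exprM; apply: lerXn2r.
  - by rewrite nnegrE !mulr_ge0 // exprn_ge0.
  - by rewrite nnegrE exprn_ge0 // mulr_ge0 // exprn_ge0.
  have -> : (M ^+ 3 * L ^+ 4) ^+ 4 = L ^+ 16 * M ^+ 12 by ring.
  by rewrite -mulrA -exprD ler_wpM2r // exprn_ge0.
rewrite mulrA ler_pdivlMr // (le_trans le3) //.
have c0 : 0 <= (K * M ^+ 8) ^+ q * (J * M ^+ 5 * a ^+ (2 * k.+1 - 1)).
  apply: mulr_ge0; first by rewrite exprn_ge0 // mulr_ge0 // exprn_ge0.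
  by rewrite !mulr_ge0 // ?exprn_ge0 // ltW.
have c1 : 0 <= 128%:R * J * M * #|` A'|%:R * a ^+ (2 * k.+1 - 1).
  by rewrite !mulr_ge0 // ltW.
move: (ler_wpM2l c0 le1) (ler_wpM2l c1 le4); rewrite -/a.
by move: ((M ^+ 3 * L ^+ 4) ^+ _) (_ ^+ q) (a ^+ _) => u v w; lra.
Qed.

(** [Tk_sumdiff_ge] for 2s-fold sums of [A'] is combined with the upper bound at n = 2s, m = 1. In
    the exponent, 6(4s - 1) comes from the lower bound for |A'|, 16(2s + 1) from the power of M^3
    log^4 |A|, and 1 from the factor [M]. *)
Lemma large_Tk_of_small_sumset (s : nat) (c1 C1 : RR) (G : zmodType)
    (A A' : {fset G}) (M : RR) :
    (2 <= s)%N -> 0 < c1 -> 0 < C1 -> 1 <= M -> A' `<=` A ->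
    c1 * #|` A|%:R / (M ^+ 3 * log2 #|` A|%:R `^ (16%:R / 3%:R)) <= #|` A'|%:R ->
    (forall n m : nat, (0 < n)%N -> (0 < m)%N ->
      #|` sumdiff n m A'|%:R <=
        C1 * (M ^+ 3 * log2 #|` A|%:R ^+ 4) ^+ (4 * (n + m))
          * M * #|` A'|%:R * (#|` A|%:R ^+ (2 * s - 1) / (Tk s A)%:R)) ->
  c1 ^+ (4 * s - 1) / C1 * (M * log2 #|` A|%:R) `^
      (- (6 * (4 * s - 1) + 16 * (2 * s + 1) + 1)%:R)
    * #|` A|%:R ^+ (2 * s) * (Tk s A)%:R <= (Tk (2 * s) A)%:R.
Proof.
move=> s2; have s0 : (0 < 2 * s)%N by lia.
have expE : [/\ (4 * s = 2 * (2 * s))%N, (4 * s = (4 * s - 1).+1)%N &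
    (4 * s - 1 = 2 * s + (2 * s - 1))%N] by split; lia.
move=> c10 C10 M1 sub; set L := log2 _; set a : RR := #|` A|%:R.
set b : RR := #|` A'|%:R; set T : RR := (Tk s A)%:R => lower upper.
have [a1|a2] := leqP #|` A| 1.
  (* The logarithm is 0, and [powR] of 0 at a nonzero exponent, even a negative one, is 0, so the
     left side vanishes. *)
  rewrite /L log2_le1 // mulr0 powR0 ?mulr0 ?mul0r ?mulr0 //.
  by rewrite oppr_eq0 pnatr_eq0 addn1.
have A0 : A != fset0 by rewrite -cardfs_gt0 ltnW.
have a0 : 0 < a by rewrite ltr0n ltnW.
have T0 : 0 < T by rewrite ltr0n Tk_gt0.
have L1 : 1 <= L by apply: (@log2_ge 1).
pose y : RR := M * L; have y1 : 1 <= y by rewrite /y; nra.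
have y0 : 0 < y by lra.
(* As M and L are at least 1, rounding 16/3 and 3 up to 6 puts everything in powers of y = ML. *)
have lower' : c1 * a <= y ^+ 6 * b.
  have pow1 : L `^ (16%:R / 3%:R) <= L ^+ 6.
    by rewrite -powR_mulrn ?ler_powR //; lra.
  have pow0 : 0 < L `^ (16%:R / 3%:R) by rewrite powR_gt0; lra.
  have M30 : 0 < M ^+ 3 by rewrite exprn_gt0; lra.
  move: lower; rewrite ler_pdivrMr; last by rewrite mulr_gt0.
  move=> /le_trans; apply; rewrite mulrC ler_wpM2r // /y exprMn.
  by rewrite ler_pM ?(ltW M30) ?(ltW pow0) // ler_weXn2l.
have b0 : 0 < b.
  have : 0 < c1 * a by rewrite mulr_gt0.
  by rewrite -(pmulr_rgt0 b (exprn_gt0 6 y0)); lra.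
have A'0 : A' != fset0 by rewrite -cardfs_gt0 -(ltr0n RR).
set T2 : RR := (Tk (2 * s) A)%:R.
pose p := a ^+ (2 * s - 1); have p0 : 0 < p by rewrite exprn_gt0.
set e := (16 * (2 * s + 1) + 1)%N.
have upper' : #|` sumdiff (2 * s) 1 A'|%:R * T <= C1 * y ^+ e * b * p.
  have := upper _ 1%N s0 isT; rewrite mulrA ler_pdivlMr // => /le_trans; apply.
  rewrite ler_wpM2r ?(ltW p0) // ler_wpM2r ?(ltW b0) // -mulrA.
  rewrite ler_wpM2l ?(ltW C10) // /e exprD expr1.
  have M0 : 0 <= M by lra.
  have L0 : 0 <= L by lra.
  have ML0 : 0 <= M ^+ 3 * L ^+ 4 by rewrite mulr_ge0 // exprn_ge0.
  have yML : (M ^+ 3 * L ^+ 4) ^+ 4 <= y ^+ 16.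
    rewrite (exprM y 4 4); apply: lerXn2r; rewrite ?nnegrE //.
      by rewrite exprn_ge0 // ltW.
    by rewrite /y [leRHS]exprMn ler_wpM2r ?exprn_ge0 // ler_weXn2l.
  rewrite ler_pM // ?exprn_ge0 //; last by rewrite /y; nra.
  move: (2 * s + 1)%N => t.
  rewrite exprM [leRHS]exprM; apply: lerXn2r; rewrite ?nnegrE //.
    exact: exprn_ge0.
  by rewrite exprn_ge0 // ltW.
have CS : b ^+ (4 * s) <= #|` sumdiff (2 * s) 1 A'|%:R * T2.
  case: expE => -> _ _; apply: (le_trans (Tk_sumdiff_ge RR (2 * s) A'0)).
  by rewrite ler_wpM2l // ler_nat Tk_mono.
have T20 : 0 <= T2 by [].
(* One power of [b] cancels against the |A'| in [upper'], whence the exponent 4s - 1. *)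
have lb : b ^+ (4 * s - 1) * T <= C1 * y ^+ e * p * T2.
  rewrite -(ler_pM2r b0).
  have -> : b ^+ (4 * s - 1) * T * b = b ^+ (4 * s) * T.
    by rewrite mulrAC -exprSr; case: expE => _ <- _.
  apply: (le_trans (ler_wpM2r (ltW T0) CS)); rewrite mulrAC.
  apply: (le_trans (ler_wpM2r T20 upper')).
  by rewrite le_eqVlt; apply/orP; left; apply/eqP; ring.
have lb2 : (c1 * a) ^+ (4 * s - 1) <= y ^+ (6 * (4 * s - 1)) * b ^+ (4 * s - 1).
  rewrite exprM -exprMn; apply: lerXn2r; rewrite // nnegrE.
    by rewrite mulr_ge0 // ltW.
  by rewrite mulr_ge0 ?(ltW b0) ?exprn_ge0 ?(ltW y0).
rewrite powRN powR_mulrn ?(ltW y0) // -/y.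
rewrite -[X in y ^+ X]addnA -/e exprD.
set w := y ^+ (6 * _) in lb2 *; set z := y ^+ e in lb *.
have w0 : 0 < w by rewrite exprn_gt0.
have z0 : 0 < z by rewrite exprn_gt0.
have aE : a ^+ (4 * s - 1) = a ^+ (2 * s) * p.
  by rewrite /p -exprD; case: expE => _ _ <-.
have -> : c1 ^+ (4 * s - 1) / C1 / (w * z) * a ^+ (2 * s) * T =
  (c1 ^+ (4 * s - 1) * a ^+ (2 * s) * T) / (C1 * (w * z)) by field; lra.
rewrite ler_pdivrMr; last by rewrite !mulr_gt0.
rewrite -(ler_pM2r p0).
have := ler_wpM2r (ltW T0) lb2; rewrite exprMn aE => h1.
have := ler_wpM2l (ltW w0) lb => h2.
by move: h1 h2; lra.
Qed.

Local Open Scope ring_scope.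
Local Open Scope fset_scope.

Theorem theorem8 :
  (* (i) absolute constants *)
  (exists c C : RR, 0 < c /\ 0 < C /\
    forall (G : zmodType) (A : {fset G}) (M : RR), 1 <= M ->
      (Tk 4 A)%:R >= (#|` A|%:R ^+ 4 * (energy A)%:R) / M ->
      exists A' : {fset G}, A' `<=` A /\
        (#|` A'|%:R >= c * #|` A|%:R / (M ^+ 3 * log2 #|` A|%:R `^ (16%:R / 3%:R))) /\
        (forall n m : nat, (0 < n)%N -> (0 < m)%N ->
           (#|` sumdiff n m A'|%:R : RR) <=
             C * (M ^+ 3 * log2 #|` A|%:R ^+ 4) ^+ (4 * (n + m))
               * M * #|` A'|%:R * (#|` A|%:R ^+ 3 / (energy A)%:R)))
  /\
  (* (ii) constants depending on s *)
  (forall s : nat, (2 <= s)%N ->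
   exists c C : RR, 0 < c /\ 0 < C /\
    forall (G : zmodType) (A : {fset G}) (M : RR), 1 <= M ->
      (Tk (2 * s) A)%:R >= (#|` A|%:R ^+ (2 * s) * (Tk s A)%:R) / M ->
      exists A' : {fset G}, A' `<=` A /\
        (#|` A'|%:R >= c * #|` A|%:R / (M ^+ 3 * log2 #|` A|%:R `^ (16%:R / 3%:R))) /\
        (forall n m : nat, (0 < n)%N -> (0 < m)%N ->
           (#|` sumdiff n m A'|%:R : RR) <=
             C * (M ^+ 3 * log2 #|` A|%:R ^+ 4) ^+ (4 * (n + m))
               * M * #|` A'|%:R * (#|` A|%:R ^+ (2 * s - 1) / (Tk s A)%:R)))
  /\
  (* (iii) converse: for any implicit constants c1, C1 in the bounds of (ii),
     there are c, C depending only on s, c1, C1 *)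
  (forall s : nat, (2 <= s)%N -> forall c1 C1 : RR, 0 < c1 -> 0 < C1 ->
   exists c C : RR, 0 < c /\ 0 < C /\
    forall (G : zmodType) (A : {fset G}) (M : RR), 1 <= M ->
    forall A' : {fset G}, A' `<=` A ->
      (#|` A'|%:R >= c1 * #|` A|%:R / (M ^+ 3 * log2 #|` A|%:R `^ (16%:R / 3%:R))) ->
      (forall n m : nat, (0 < n)%N -> (0 < m)%N ->
           (#|` sumdiff n m A'|%:R : RR) <=
             C1 * (M ^+ 3 * log2 #|` A|%:R ^+ 4) ^+ (4 * (n + m))
               * M * #|` A'|%:R * (#|` A|%:R ^+ (2 * s - 1) / (Tk s A)%:R)) ->
      (Tk (2 * s) A)%:R >=
        c * (M * log2 #|` A|%:R) `^ (- C) * #|` A|%:R ^+ (2 * s) * (Tk s A)%:R).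
Proof.
have c0 : 0 < 128%:R^-1 :> RR by rewrite invr_gt0.
have C0 : 0 < 2 ^+ 29 :> RR by rewrite exprn_gt0.
split; [|split].
- exists 128%:R^-1, (2 ^+ 29); do 2![split=> //] => G A M M1.
  by rewrite !energyE; apply: (@structured_subset 2).
- move=> s s2; exists 128%:R^-1, (2 ^+ 29); do 2![split=> //] => G A M M1.
  exact: structured_subset.
- move=> s s2 c1 C1 c10 C10.
  exists (c1 ^+ (4 * s - 1) / C1), (6 * (4 * s - 1) + 16 * (2 * s + 1) + 1)%N%:R.
  split; first by rewrite divr_gt0 // exprn_gt0.
  split; first by rewrite ltr0n addn1.
  by move=> G A M M1 A' sub lower upper; apply: large_Tk_of_small_sumset upper.
Qed.
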